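(* Let $C\subset\mathbb{P}^2$ be a rational curve given by a proper parameterization $(f_0:f_1:f_2)$, $f_u\in K[s,t]_n$, $n\ge 3$, and let $2\le j\le n-1$. Let $Z_j$, $Z'_j$ be as in the context, let $R\in Z_j\setminus Z'_j$, and let $\overline\lambda=(\lambda_1,\dots,\lambda_j)$ be the partition of $j$ minimal (with respect to $\preceq$) such that $R\in\mathcal{R}_{\overline\lambda}$. Let $P=\pi(H_R)\in C$ be the singular point associated to $R$. Then the number of branches of $C$ at $P$ is $l(\overline\lambda)$, the number of the $\lambda_i$'s different from zero. Moreover, for $i=1,\dots,l(\overline\lambda)$, the $i$-th branch of $C$ at $P$ has multiplicity $\lambda_i$ at $P$ (for a suitable ordering of the branches).
   Context: $K$ is an algebraically closed field of characteristic $0$, $\mathbb{P}^m=\mathbb{P}^m_K$. $C\subset\mathbb{P}^2$ is the image of $\mathbf f=(f_0:f_1:f_2)$, $f_u=\sum_{j=0}^n a_{uj}s^{n-j}t^j\in K[s,t]_n$. Proper means: $\mathbf f$ is generically $1:1$ onto $C$ and the $f_u$ have no common zeroes. For $2\le k\le n-1$, $M_k$ is the $(n-k+4)\times(n+1)$ matrix (columns numbered $0,\dots,n$) whose first $n-k+1$ rows are indexed by $i=0,\dots,n-k$, the $i$-th having entries $x_0,\dots,x_k$ in columns $i,\dots,i+k$ and $0$ elsewhere, and whose last three rows are $(a_{u0},\dots,a_{un})$, $u=0,1,2$. $X_k\subset\mathbb{P}^k$ is the scheme defined by the $(n-k+3)$-minors of $M_k$, and $Z_k$ is its reduced support. $C_n=\nu_n(\mathbb{P}^1)\subset\mathbb{P}^n$,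 $\nu_n(s:t)=(s^n:s^{n-1}t:\dots:t^n)$; $\pi:\mathbb{P}^n\dashrightarrow\mathbb{P}^2$, $\pi(z_0:\dots:z_n)=(\sum_j a_{0j}z_j:\sum_j a_{1j}z_j:\sum_j a_{2j}z_j)$, with center $\Pi$, so $\Pi\cap C_n=\emptyset$ and $\pi\circ\nu_n=\mathbf f$. A point $R=(a_0:\dots:a_k)\in\mathbb{P}^k$ is identified with the class of the form $G_R=\sum_i a_is^{k-i}t^i$, whose zeros give a degree $k$ divisor on $C_n\cong\mathbb{P}^1$ with linear span the $(k-1)$-space $H_R\subset\mathbb{P}^n$. For $R\in Z_k$, $\pi(H_R\setminus\Pi)$ is a single point, a singular point of $C$, denoted $\pi(H_R)$. For $2\le k\le n-2$, $Z'_k\subset Z_k$ is the set of $R\in Z_k$ which come from $Z_{k+1}$: there are $\tilde R\in Z_{k+1}$ and a linear form $L$ with $G_{\tilde R}=LG_R$ up to scalar. Set $Z'_{n-1}=\emptyset$. Partitions of $k$ are written $\overline\lambda=(\lambda_1,\dots,\lambda_k)$ with $\lambda_1\ge\dots\ge\lambda_k\ge0$, $\sum\lambda_i=k$. $\mathcal{R}_{\overline\lambda}\subset\mathbb{P}^k=\mathbb{P}(K[s,t]_k)$ is the set of classes of forms $L_1^{\lambda_1}\cdots L_k^{\lambda_k}$, $L_i$ linear forms. $\overline\lambda\preceq\overline\lambda'$ means that $\overline\lambda'$ is obtained from $\overline\lambda$ by substituting some parts with partitions of them. Branches: let $P\in\operatorname{Sing}C$ and let $Q_1,\dots,Q_r\in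 C_n$ be the (distinct) points with $\pi|_{C_n}(Q_i)=P$; then $C$ has $r$ branches at $P$. If $(\pi|_{C_n})^{-1}(P)=\mu_1Q_1+\dots+\mu_rQ_r$ as a (scheme-theoretic preimage) divisor on $C_n$, the $i$-th branch of $C$ has multiplicity $\mu_i$ at $P$. *)

(* Defs.v *)
(* A point of P^m is given by a nonzero row vector v : 'rV[K]_m.+1, and
   (v == w)%MS (equality of row spaces) says that two nonzero vectors are the
   same point.  The variables s, t of binary forms are 'X_0, 'X_1. *)
From mathcomp Require Import all_boot all_order all_algebra.
From mathcomp Require Import mpoly.

Set Implicit Arguments.
Unset Strict Implicit.
Unset Printing Implicit Defensive.

Import GRing.Theory.
Local Open Scope ring_scope.

Section Defs.
Variable K : closedFieldType.

(* sum_i c_i s^(n-i) t^i *)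
Definition form n (c : 'rV[K]_n.+1) : {mpoly K[2]} :=
  \sum_(i < n.+1) c 0 i *: ('X_0 ^+ (n - i) * 'X_1 ^+ i).

Definition mdvd (m : nat) (p q : {mpoly K[m]}) : Prop := exists r, q = r * p.

Definition proportional (m : nat) (p q : {mpoly K[m]}) : Prop :=
  exists2 c : K, c != 0 & p = c *: q.

(* A linear form whose only zero on P^1 is Q. *)
Definition point_form (Q : 'rV[K]_2) : {mpoly K[2]} :=
  Q 0 1 *: 'X_0 - Q 0 0 *: 'X_1.

(* f_u is form (row u a). *)
Definition param n (a : 'M[K]_(3, n.+1)) (p : 'rV[K]_2) : 'rV[K]_3 :=
  \row_u (form (row u a)).@[p 0].

(* "Generically 1:1 onto C": some nonempty principal open subset F <> 0 of the
   image C consists of points with exactly one preimage in P^1. *)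
Definition generically_injective n (a : 'M[K]_(3, n.+1)) : Prop :=
  exists (d : nat) (F : {mpoly K[3]}),
    [/\ F \is d.-homog,
        exists2 p : 'rV[K]_2, p != 0 & F.@[param a p 0] != 0
      & forall p q : 'rV[K]_2, p != 0 -> q != 0 -> F.@[param a p 0] != 0 ->
          (param a p == param a q)%MS -> (p == q)%MS].

Definition proper_param n (a : 'M[K]_(3, n.+1)) : Prop :=
  (forall p : 'rV[K]_2, p != 0 -> param a p != 0) /\ generically_injective a.

(* The matrix M_k at the point R = (x_0 : ... : x_k). *)
Definition Mk n (a : 'M[K]_(3, n.+1)) k (R : 'rV[K]_k.+1) :
    'M[K]_((n - k).+1 + 3, n.+1) :=
  col_mx (\matrix_(i, j) if (i <= j <= i + k)%N then R 0 (inord (j - i)) else 0)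
         a.

(* The points of the reduced support of X_k.  Choices of rows and columns that
   are not increasing only add minors that vanish or repeat up to sign. *)
Definition Z n (a : 'M[K]_(3, n.+1)) k (R : 'rV[K]_k.+1) : Prop :=
  R != 0 /\
  forall (f : 'I_(n - k + 3) -> 'I_((n - k).+1 + 3))
         (g : 'I_(n - k + 3) -> 'I_n.+1),
    \det (mxsub f g (Mk a R)) = 0.

(* The first conjunct is k <= n - 2; it makes Z'_(n-1) empty. *)
Definition Z' n (a : 'M[K]_(3, n.+1)) k (R : 'rV[K]_k.+1) : Prop :=
  [/\ (k.+2 <= n)%N, Z a R
    & exists Rt : 'rV[K]_k.+2, Z a Rt /\
      exists2 L : {mpoly K[2]}, L \is 1.-homog
        & proportional (form Rt) (L * form R)].

Definition veronese n (p : 'rV[K]_2) : 'rV[K]_n.+1 :=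
  \row_(j < n.+1) (p 0 0 ^+ (n - j) * p 0 1 ^+ j).

Definition proj n (a : 'M[K]_(3, n.+1)) (z : 'rV[K]_n.+1) : 'rV[K]_3 :=
  z *m a^T.

Definition in_center n (a : 'M[K]_(3, n.+1)) (z : 'rV[K]_n.+1) : Prop :=
  proj a z = 0.

Lemma proj_veronese n (a : 'M[K]_(3, n.+1)) (p : 'rV[K]_2) :
  proj a (veronese n p) = param a p.
Proof.
apply/rowP=> u; rewrite !mxE /form rmorph_sum /=; apply: eq_bigr => i _.
by rewrite !mxE mevalZ rmorphM !rmorphXn /= !mevalXU mulrC.
Qed.

(* H_R, the linear span of the divisor of G_R = form R on C_n, is the
   intersection of the hyperplanes sum_j h_j z_j = 0 that contain this divisor;
   such a hyperplane cuts the divisor of form h on C_n. *)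
Definition in_span n k (R : 'rV[K]_k.+1) (z : 'rV[K]_n.+1) : Prop :=
  z != 0 /\
  forall h : 'rV[K]_n.+1, mdvd (form R) (form h) -> \sum_j h 0 j * z 0 j = 0.

(* P = pi(H_R): the set pi(H_R \ Pi) is the single point P. *)
Definition is_proj_span n (a : 'M[K]_(3, n.+1)) k (R : 'rV[K]_k.+1)
    (P : 'rV[K]_3) : Prop :=
  P != 0 /\
  forall x : 'rV[K]_3, x != 0 ->
    (exists z, [/\ in_span R z, ~ in_center a z & (proj a z == x)%MS])
    <-> (x == P)%MS.

Definition is_partn k (l : k.-tuple nat) : Prop := sorted geq l /\ sumn l = k.

Definition partn_length k (l : k.-tuple nat) : nat := count (ltn 0) l.

(* l' is obtained from l by replacing each part l_i by a partition nu_i of l_i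
   (possibly the trivial one); zero parts are padding. *)
Definition refines k (l l' : k.-tuple nat) : Prop :=
  exists nu : 'I_k -> seq nat,
    (forall i, sumn (nu i) = tnth l i) /\
    perm_eq [seq x <- l' | 0 < x]%N
            [seq x <- flatten [seq nu i | i <- enum 'I_k] | 0 < x]%N.

Definition in_stratum k (l : k.-tuple nat) (R : 'rV[K]_k.+1) : Prop :=
  R != 0 /\
  exists L : 'I_k -> {mpoly K[2]},
    (forall i, L i \is 1.-homog) /\
    proportional (form R) (\prod_(i < k) L i ^+ tnth l i).

Definition minimal_partn k (R : 'rV[K]_k.+1) (l : k.-tuple nat) : Prop :=
  [/\ is_partn l, in_stratum l R
    & forall l' : k.-tuple nat,
        is_partn l' -> in_stratum l' R -> refines l' l -> l' = l].

(* The branches of C at P are the points of C_n over P; Q_1, ..., Q_r lists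
   them, without repetition, by their parameters in P^1. *)
Definition branches n (a : 'M[K]_(3, n.+1)) (P : 'rV[K]_3) r
    (Q : 'I_r -> 'rV[K]_2) : Prop :=
  [/\ forall i, Q i != 0,
      forall i i', (Q i == Q i')%MS -> i = i'
    & forall p : 'rV[K]_2, p != 0 ->
        (proj a (veronese n p) == P)%MS <-> exists i, (p == Q i)%MS].

(* The homogeneous F(x_0,x_1,x_2) vanishing at P pull back to the forms
   F(f_0,f_1,f_2), which cut out the scheme-theoretic preimage of P. *)
Definition preimage_ge n (a : 'M[K]_(3, n.+1)) (P : 'rV[K]_3) (Q : 'rV[K]_2)
    (m : nat) : Prop :=
  forall (d : nat) (F : {mpoly K[3]}), F \is d.-homog -> F.@[P 0] = 0 ->
    mdvd (point_form Q ^+ m) (comp_mpoly [tuple form (row u a) | u < 3] F).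

(* m is the coefficient of Q in the divisor that is the preimage of P. *)
Definition branch_mult n (a : 'M[K]_(3, n.+1)) (P : 'rV[K]_3) (Q : 'rV[K]_2)
    (m : nat) : Prop :=
  preimage_ge a P Q m /\ ~ preimage_ge a P Q m.+1.

End Defs.

(* Main.v *)
(* The condition R in Z_k bounds the rank of M_k, so at least a pencil of
   combinations u.f of f_0, f_1, f_2 is divisible by G_R.  Every such u is
   orthogonal to P = pi(H_R), hence G_R divides u.f for all u in the plane
   orthogonal to P, that is, the divisor of G_R is contained in the preimage of
   P.  If a point p occurred in that preimage more often than in G_R, then
   L_p G_R would still divide all these u.f; by the same rank count L_p G_R
   would be in Z_(k+1), against R not in Z'_k, or, for k = n-1, C would be a
   line, which has no proper parameterization of degree n > 1.  So the preimage
   is exactly the divisor of G_R, whose multiplicities are the parts of the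
   minimal partition. *)
From Pilot Require Import Defs.
From mathcomp Require Import all_boot all_order all_algebra.
From mathcomp Require Import perm mpoly zify.

Set Implicit Arguments.
Unset Strict Implicit.
Unset Printing Implicit Defensive.

Import GRing.Theory.
Local Open Scope ring_scope.

(* all_algebra hides form of Defs. *)
Import Pilot.Defs.

(** * Divisibility and congruence of multivariate polynomials *)

Section Divisibility.
Variables (K : closedFieldType) (m : nat).
Implicit Types p q g h : {mpoly K[m]}.

Lemma mdvd_refl p : mdvd p p.
Proof. by exists 1; rewrite mul1r. Qed.

Lemma mdvd0 p : mdvd p 0.
Proof. by exists 0; rewrite mul0r. Qed.

Lemma mdvdD g p q : mdvd g p -> mdvd g q -> mdvd g (p + q).
Proof. by move=> [r ->] [s ->]; exists (r + s); rewrite mulrDl. Qed.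

Lemma mdvd_mull g p q : mdvd g p -> mdvd g (q * p).
Proof. by move=> [r ->]; exists (q * r); rewrite mulrA. Qed.

Lemma mdvd_trans g p q : mdvd g p -> mdvd p q -> mdvd g q.
Proof. by move=> gp [r ->]; apply: mdvd_mull. Qed.

Lemma mdvdZ g p c : mdvd g p -> mdvd g (c *: p).
Proof. by rewrite -mul_mpolyC; apply: mdvd_mull. Qed.

Lemma mdvd_sum g (I : Type) (r : seq I) (F : I -> {mpoly K[m]}) :
  (forall i, mdvd g (F i)) -> mdvd g (\sum_(i <- r) F i).
Proof.
by move=> gF; apply: big_ind => // [|p q]; [apply: mdvd0 | apply: mdvdD].
Qed.

Lemma mdvd_subM g p q p' q' :
  mdvd g (p - p') -> mdvd g (q - q') -> mdvd g (p * q - p' * q').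
Proof.
move=> gp gq; have ->: p * q - p' * q' = q * (p - p') + p' * (q - q').
  by rewrite !mulrBr (mulrC q p) (mulrC q p') addrA addrNK.
by apply: mdvdD; apply: mdvd_mull.
Qed.

Lemma mdvd_subX g p p' k : mdvd g (p - p') -> mdvd g (p ^+ k - p' ^+ k).
Proof. by rewrite subrXX mulrC; apply: mdvd_mull. Qed.

(** Congruence modulo [g] passes through products, powers and linear combinations, hence through
    substitution into [F]. *)
Lemma mdvd_sub_comp k g (x y : k.-tuple {mpoly K[m]}) (F : {mpoly K[k]}) :
  (forall i, mdvd g (tnth x i - tnth y i)) -> mdvd g ((F \mPo x) - (F \mPo y)).
Proof.
move=> gxy; rewrite !comp_mpolyE -sumrB; apply: mdvd_sum => mon.
rewrite -scalerBr; apply: mdvdZ.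
apply: (big_ind2 (fun p q => mdvd g (p - q))) => [||i _].
- by rewrite subrr; apply: mdvd0.
- by move=> *; apply: mdvd_subM.
- by apply: mdvd_subX.
Qed.

Lemma comp_homogZ k d (F : {mpoly K[k]}) (P : 'I_k -> K) h :
  F \is d.-homog -> F \mPo [tuple P i *: h | i < k] = F.@[P] *: h ^+ d.
Proof.
move=> /dhomogP homF; rewrite comp_mpolyE mevalE scaler_suml.
rewrite big_seq [RHS]big_seq; apply: eq_bigr => mon /homF.
rewrite /= mdegE -scalerA => <-; congr (_ *: _).
rewrite -prodrXr -mul_mpolyC rmorph_prod -big_split /=.
by apply: eq_bigr => i _; rewrite tnth_mktuple exprZn -mul_mpolyC.
Qed.

(* Modulo g, the point x is the multiple y of P. *)
Lemma mdvd_homog_comp k d g (x : k.-tuple {mpoly K[m]}) (F : {mpoly K[k]})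
    (P : 'I_k -> K) y :
  F \is d.-homog -> F.@[P] = 0 ->
  (forall i, mdvd g (tnth x i - P i *: y)) -> mdvd g (F \mPo x).
Proof.
move=> homF FP0 gx; have := @mdvd_sub_comp k g x [tuple P i *: y | i < k] F.
rewrite (comp_homogZ _ _ homF) FP0 scale0r subr0; apply => i.
by rewrite tnth_mktuple.
Qed.

(** Multiplication by a homogeneous [p] shifts the degree of each monomial of [g] by [d]. *)
Lemma pihomogM d e p g : p \is d.-homog ->
  (d <= e)%N -> pihomog mdeg e (g * p) = pihomog mdeg (e - d) g * p.
Proof.
move=> homp le_de; rewrite [g]mpolyE mulr_suml !raddf_sum mulr_suml /=.
apply: eq_bigr => mon _; rewrite -scalerAl !linearZ /= -scalerAl.
congr (_ *: _).
have homXp : 'X_[mon] * p \is (mdeg mon + d).-homog.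
  by apply: dhomogM => //; rewrite dhomogX.
rewrite pihomogX; case: eqP => [eq_mon|neq_mon].
  by apply: pihomog_dE; rewrite -(subnK le_de) -eq_mon.
rewrite mul0r; apply: (pihomog_ne0 _ homXp); apply/eqP => eq_e.
by apply: neq_mon; rewrite -eq_e addnK.
Qed.

(** The cofactor given by [mdvd] may be inhomogeneous; its component of degree [e - d] serves as
    well, because [q] is its own component of degree [e]. *)
Lemma mdvd_homogP d e p q : p \is d.-homog -> q \is e.-homog ->
  (d <= e)%N -> mdvd p q -> exists2 r, r \is (e - d).-homog & q = r * p.
Proof.
move=> homp homq le_de [r def_q]; exists (pihomog mdeg (e - d) r).
  exact: pihomogP.
by rewrite -pihomogM // -def_q pihomog_dE.
Qed.

End Divisibility.

(** * Binary forms and their coefficient rows *)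

Section BinaryForms.
Variable K : closedFieldType.

(** A nonzero [q] with these values is not constant, so [q + 1] has a root, and there [q] takes the
    value -1. *)
Lemma poly_vanish (q : {poly K}) : (forall x, q.[x] = 0) -> q = 0.
Proof.
move=> q0; apply/eqP; apply: contraT => nz_q.
have /closed_rootP[x /rootP] : size (q + 1) != 1%N.
  apply: contra nz_q => /size_poly1P[c nz_c def_q].
  have q_cst : q = (c - 1)%:P by rewrite polyCB -def_q addrK.
  by have:= q0 0; rewrite q_cst hornerC => ->.
by rewrite hornerD q0 add0r hornerC => /eqP; rewrite oner_eq0.
Qed.

Lemma poly_vanish_outside (h w : {poly K}) :
  h != 0 -> (forall x, h.[x] != 0 -> w.[x] = 0) -> w = 0.
Proof.
move=> nz_h hw; have: h * w = 0.
  apply: poly_vanish => x; rewrite hornerM.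
  by have [->|/hw->] := eqVneq h.[x] 0; rewrite ?mul0r ?mulr0.
by move/eqP; rewrite mulf_eq0 (negPf nz_h) => /eqP.
Qed.

(** The chart s = 1 of P^1, in which forms become univariate polynomials. *)
Definition affine_point (x : K) : 'rV[K]_2 := \row_i x ^+ i.

Lemma affine_point_neq0 x : affine_point x != 0.
Proof.
apply/eqP => /rowP/(_ 0) /eqP.
by rewrite !mxE expr0 oner_eq0.
Qed.

Lemma affine_point_inj x y :
  (affine_point x == affine_point y)%MS -> x = y.
Proof.
case/andP=> /sub_rVP[c /rowP def_x] _.
have:= def_x 0; rewrite !mxE !expr0 mulr1 => c1.
by have:= def_x 1; rewrite !mxE !expr1 -c1 mul1r.
Qed.

Lemma formE n (c : 'rV[K]_n.+1) p :
  (form c).@[p] = \sum_(i < n.+1) c 0 i * (p 0 ^+ (n - i) * p 1 ^+ i).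
Proof.
rewrite /form raddf_sum; apply: eq_bigr => i _ /=.
by rewrite mevalZ rmorphM !rmorphXn /= !mevalXU.
Qed.

Lemma form_veronese n (c : 'rV[K]_n.+1) (p : 'rV[K]_2) :
  (form c).@[p 0] = (c *m (veronese n p)^T) 0 0.
Proof. by rewrite formE mxE; apply: eq_bigr => i _; rewrite !mxE. Qed.

Lemma form_affine n (c : 'rV[K]_n.+1) x :
  (form c).@[affine_point x 0] = (rVpoly c).[x].
Proof.
rewrite formE [rVpoly c]/rVpoly horner_poly; apply: eq_bigr => i _.
by rewrite !mxE expr0 expr1 expr1n mul1r insubT //= => ?; congr (c 0 _ * _);
  apply: val_inj.
Qed.

Lemma form_eq0 n (c : 'rV[K]_n.+1) : form c = 0 -> c = 0.
Proof.
move=> c0; rewrite -[c]rVpolyK [rVpoly c]poly_vanish ?linear0 // => x.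
by rewrite -form_affine c0 meval0.
Qed.

Lemma form_mulmx m n (u : 'rV[K]_m) (A : 'M[K]_(m, n.+1)) :
  form (u *m A) = \sum_i u 0 i *: form (row i A).
Proof.
transitivity (\sum_(j < n.+1) \sum_i
    (u 0 i * A i j) *: ('X_0 ^+ (n - j) * 'X_1 ^+ j) : {mpoly K[2]}).
  by apply: eq_bigr => j _; rewrite mxE scaler_suml.
rewrite exchange_big; apply: eq_bigr => i _ /=.
by rewrite scaler_sumr; apply: eq_bigr => j _; rewrite mxE scalerA.
Qed.

Lemma form_sub n (c d : 'rV[K]_n.+1) : form (c - d) = form c - form d.
Proof. by rewrite -sumrB; apply: eq_bigr => i _; rewrite !mxE scalerBl. Qed.

Lemma formZ n x (c : 'rV[K]_n.+1) : form (x *: c) = x *: form c.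
Proof.
by rewrite scaler_sumr; apply: eq_bigr => i _; rewrite !mxE scalerA.
Qed.

Lemma form0 n : form (0 : 'rV[K]_n.+1) = 0.
Proof. by rewrite /form big1 // => i _; rewrite mxE scale0r. Qed.

Lemma form_inj n : injective (@form K n).
Proof.
move=> c d eq_cd; apply/eqP; rewrite -subr_eq0; apply/eqP/form_eq0.
by rewrite form_sub eq_cd subrr.
Qed.

Lemma form_homog n (c : 'rV[K]_n.+1) : form c \is n.-homog.
Proof.
apply: rpred_sum => i _; apply: rpredZ.
have homX k e : 'X_k ^+ e \is [in K[2], e.-homog].
  by have:= @dhomogMn 2 K mdeg 1 'X_k e; rewrite mul1n dhomogX /= mdeg1; apply.
have:= dhomogM (homX 0 (n - i)%N) (homX 1 (i : nat)).
by rewrite subnK // -ltnS.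
Qed.

Lemma homog_form n (p : {mpoly K[2]}) :
  p \is n.-homog -> exists c : 'rV[K]_n.+1, p = form c.
Proof.
move=> /dhomogP homp; rewrite [p]mpolyE big_seq.
apply: (big_ind (fun q => exists c : 'rV[K]_n.+1, q = form c))
  => [|_ _ [c ->] [d ->]|mon /homp /= deg_mon].
- by exists 0; rewrite form0.
- exists (c - - d); rewrite form_sub -[- d]scaleN1r formZ.
  by rewrite scaleN1r opprK.
pose i1 : 'I_2 := 1; have i1E : lift ord0 ord0 = i1 by apply: val_inj.
rewrite mdegE !big_ord_recl big_ord0 addn0 i1E in deg_mon.
exists (p@_mon *: delta_mx 0 (inord (mon i1))).
rewrite formZ; congr (_ *: _).
have lt_mon : (mon i1 < n.+1)%N by rewrite ltnS -deg_mon leq_addl.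
rewrite /form (bigD1 (inord (mon i1))) //= big1 => [|i /negPf neq_i].
  rewrite mxE !eqxx scale1r addr0 inordK // mpolyXE_id.
  by rewrite !big_ord_recl big_ord0 mulr1 i1E -deg_mon addnK.
by rewrite mxE eqxx /= neq_i scale0r.
Qed.

End BinaryForms.

(** * Linear forms and points of P^1 *)

Section PointForms.
Variable K : closedFieldType.
Implicit Types p Q : 'rV[K]_2.

Lemma row_eqmx n (u v : 'rV[K]_n) : u != 0 -> (u <= v)%MS -> (u == v)%MS.
Proof.
move=> nz_u uv; rewrite uv /=; case/sub_rVP: uv nz_u => c ->.
have [->|nz_c _] := eqVneq c 0; first by rewrite scale0r eqxx.
by rewrite eqmx_scale.
Qed.

Lemma rV2_neq0 p : p != 0 -> (p 0 0 != 0) || (p 0 1 != 0).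
Proof.
apply: contraR; rewrite negb_or !negbK => /andP[/eqP p0 /eqP p1].
apply/eqP/rowP => -[[|[|//]] lti]; rewrite mxE.
  by rewrite -[RHS]p0; congr (p 0 _); apply: val_inj.
by rewrite -[RHS]p1; congr (p 0 _); apply: val_inj.
Qed.

Lemma point_formE Q p :
  (point_form Q).@[p 0] = Q 0 1 * p 0 0 - Q 0 0 * p 0 1.
Proof. by rewrite raddfB /= !mevalZ !mevalXU. Qed.

Lemma point_form_eq0 Q p : Q != 0 -> p != 0 ->
  ((point_form Q).@[p 0] == 0) = (p == Q)%MS.
Proof.
move=> nzQ nzp; rewrite point_formE subr_eq0; apply/eqP/idP => [eqQp|].
  apply: row_eqmx => //; apply/sub_rVP.
  case/orP: (rV2_neq0 nzQ) => nzQi.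
    exists (p 0 0 / Q 0 0); apply/rowP => -[[|[|//]] lti]; rewrite mxE.
      rewrite (_ : Ordinal lti = 0) ?divfK //; exact: val_inj.
    rewrite (_ : Ordinal lti = 1) 1?mulrAC; last exact: val_inj.
    by rewrite (mulrC (p 0 0)) eqQp mulrAC divff ?mul1r.
  exists (p 0 1 / Q 0 1); apply/rowP => -[[|[|//]] lti]; rewrite mxE.
    rewrite (_ : Ordinal lti = 0) 1?mulrAC; last exact: val_inj.
    by rewrite (mulrC (p 0 1)) -eqQp mulrAC divff ?mul1r.
  rewrite (_ : Ordinal lti = 1) ?divfK //; exact: val_inj.
case/andP=> /sub_rVP[c ->] _.
by rewrite !mxE mulrCA (mulrC (Q 0 1)) [RHS]mulrCA.
Qed.

Lemma point_form_homog Q : point_form Q \is 1.-homog.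
Proof.
by apply: rpredB; apply: rpredZ; rewrite dhomogX /= mdeg1.
Qed.

Lemma point_form_neq0 Q : Q != 0 -> point_form Q != 0.
Proof.
move=> nzQ; apply/eqP => Q0.
have all_eq p : p != 0 -> (p == Q)%MS.
  by move=> nzp; rewrite -point_form_eq0 // Q0 meval0.
have /eqmxP eq0 := all_eq _ (affine_point_neq0 0).
have /eqmxP eq1 := all_eq _ (affine_point_neq0 1).
have /eqP : 0 = 1 :> K by apply: affine_point_inj; rewrite !eq0 !eq1 submx_refl.
by rewrite eq_sym oner_eq0.
Qed.

Lemma linear_form_point (L : {mpoly K[2]}) :
  L \is 1.-homog -> L != 0 -> exists2 Q, Q != 0 & L = point_form Q.
Proof.
move=> /homog_form[c ->] nzL.
pose Q := \row_(i < 2) if i == 0 then - c 0 1 else c 0 0.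
have eqL : form c = point_form Q.
  rewrite /form !big_ord_recl big_ord0 /= addr0 /point_form !mxE /=.
  rewrite expr1 expr0 mulr1 subnn expr0 mul1r expr1 scaleNr opprK.
  by congr (_ + c 0 _ *: _); apply: val_inj.
exists Q => //; apply: contraNneq nzL => Q0.
by rewrite eqL Q0 /point_form !mxE !scale0r subrr.
Qed.

Lemma point_form_eqmx Q p : (p == Q)%MS ->
  exists c, point_form p = c *: point_form Q.
Proof.
case/andP=> /sub_rVP[c ->] _; exists c.
by rewrite /point_form !mxE scalerBr !scalerA.
Qed.

(** Modulo [point_form p] the pair of variables is a multiple of [p]: the multiplier [y] is one
    variable divided by a nonzero coordinate of [p]. By homogeneity [h] is then congruent to [h(p)]
    times a power of [y]. *)
Lemma point_form_dvd p d (h : {mpoly K[2]}) :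
  p != 0 -> h \is d.-homog -> h.@[p 0] = 0 -> mdvd (point_form p) h.
Proof.
move=> nzp homh hp0; rewrite -[h]comp_mpoly_id.
case/orP: (rV2_neq0 nzp) => nzpi.
  apply: (mdvd_homog_comp (y := (p 0 0)^-1 *: 'X_0) homh hp0) => i.
  rewrite tnth_mktuple scalerA; case: i => -[|[|//]] lti.
    rewrite (_ : Ordinal lti = 0); last exact: val_inj.
    by rewrite divff // scale1r subrr; apply: mdvd0.
  rewrite (_ : Ordinal lti = 1); last exact: val_inj.
  have ->: 'X_1 - (p 0 1 / p 0 0) *: 'X_0 = - (p 0 0)^-1 *: point_form p.
    rewrite scalerBr !scalerA !mulNr mulVf // !scaleNr scale1r opprK.
    by rewrite addrC mulrC.
  exact/mdvdZ/mdvd_refl.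
apply: (mdvd_homog_comp (y := (p 0 1)^-1 *: 'X_1) homh hp0) => i.
rewrite tnth_mktuple scalerA; case: i => -[|[|//]] lti; last first.
  rewrite (_ : Ordinal lti = 1); last exact: val_inj.
  by rewrite divff // scale1r subrr; apply: mdvd0.
rewrite (_ : Ordinal lti = 0); last exact: val_inj.
have ->: 'X_0 - (p 0 0 / p 0 1) *: 'X_1 = (p 0 1)^-1 *: point_form p.
  by rewrite scalerBr !scalerA mulVf // scale1r mulrC.
exact/mdvdZ/mdvd_refl.
Qed.

Lemma mdvd_meval0 m (p : 'I_m -> K) (g h : {mpoly K[m]}) :
  mdvd g h -> g.@[p] = 0 -> h.@[p] = 0.
Proof. by move=> [r ->] g0; rewrite mevalM g0 mulr0. Qed.

End PointForms.

(** * Multiples of G_R as a row space *)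

Section Band.
Variable K : closedFieldType.

(* The rows are the coefficients of s^(n-k-i) t^i G_R. *)
Definition band n k (R : 'rV[K]_k.+1) : 'M[K]_((n - k).+1, n.+1) :=
  \matrix_(i, j) if (i <= j <= i + k)%N then R 0 (inord (j - i)) else 0.

Lemma form_row_band n k (R : 'rV[K]_k.+1) (i : 'I_(n - k).+1) :
  (k <= n)%N ->
  form (row i (band n R)) = 'X_0 ^+ (n - k - i) * 'X_1 ^+ i * form R.
Proof.
move=> le_kn; have le_i : (i + k <= n)%N.
  by rewrite addnC -leq_subRL // -ltnS.
rewrite /form (bigID (fun j : 'I__ => i <= j <= i + k)%N) /= addrC big1 ?add0r.
  pose h (l : 'I_k.+1) : 'I_n.+1 := inord (i + l).
  have hE l : h l = (i + l)%N :> nat.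
    by rewrite inordK // ltnS (leq_trans _ le_i) // leq_add2l -ltnS.
  rewrite (reindex_onto h (fun j => inord (j - i))) /=
    => [|j /andP[le_ij le_jk]].
    rewrite mulr_sumr; apply: eq_big => [l|l _].
      by rewrite hE leq_addr leq_add2l -ltnS ltn_ord addKn inord_val eqxx.
    rewrite !mxE hE leq_addr leq_add2l -ltnS ltn_ord addKn inord_val.
    rewrite -scalerAr; congr (_ *: _).
    rewrite mulrACA -!exprD; congr ('X_0 ^+ _ * _).
    have le_l : (l <= k)%N by rewrite -ltnS.
    apply/eqP; rewrite -(eqn_add2r (i + l)) subnK; last first.
      by rewrite (leq_trans _ le_i) // leq_add2l.
    by rewrite addnACA !subnK // -ltnS.
  apply: val_inj; rewrite /= hE inordK ?subnKC //.
  by rewrite ltnS leq_subLR.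
by move=> j /negPf; rewrite !mxE => ->; rewrite scale0r.
Qed.

Lemma form_mulmx_band n k (R : 'rV[K]_k.+1) (q : 'rV[K]_(n - k).+1) :
  (k <= n)%N -> form (q *m band n R) = form q * form R.
Proof.
move=> le_kn; rewrite form_mulmx mulr_suml; apply: eq_bigr => i _.
by rewrite form_row_band // scalerAl.
Qed.

(** A homogeneous cofactor has degree [n - k], and its coefficients are those of a combination of
    the rows of [band n R]. This turns divisibility by G_R into linear algebra. *)
Lemma mdvd_formP n k (R : 'rV[K]_k.+1) (h : 'rV[K]_n.+1) : (k <= n)%N ->
  mdvd (form R) (form h) <-> (h <= band n R)%MS.
Proof.
move=> le_kn; split=> [dvd_h|/submxP[q ->]]; last first.
  by exists (form q); rewrite form_mulmx_band.
have [r homr def_h] := mdvd_homogP (form_homog R) (form_homog h) le_kn dvd_h.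
have [q def_r] := homog_form homr.
rewrite (_ : h = q *m band n R) ?submxMl //.
by apply: form_inj; rewrite form_mulmx_band // -def_r.
Qed.

Lemma band_free n k (R : 'rV[K]_k.+1) :
  (k <= n)%N -> R != 0 -> row_free (band n R).
Proof.
move=> le_kn nzR; apply: inj_row_free => q qR0.
have /eqP := form_mulmx_band R q le_kn.
rewrite qR0 form0 eq_sym mulf_eq0.
by case/orP=> /eqP/form_eq0 // R0; rewrite R0 eqxx in nzR.
Qed.

End Band.

(** * Vanishing of minors and rank *)

Section Minors.
Variable F : fieldType.

Lemma mxrank_mxsub m n p q (A : 'M[F]_(m, n))
    (f : 'I_p -> 'I_m) (g : 'I_q -> 'I_n) :
  (\rank (mxsub f g A) <= \rank A)%N.
Proof.
rewrite mxsubcr (leq_trans _ (mxrankS (rowsub_sub f A))) //.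
rewrite -mxrank_tr (_ : _^T = rowsub g (rowsub f A)^T); last first.
  by apply/matrixP=> i j; rewrite !mxE.
by rewrite -[leqRHS]mxrank_tr mxrankS ?rowsub_sub.
Qed.

Lemma rowsub_free m n p (A : 'M[F]_(m, n)) (f : 'I_p -> 'I_m) :
  injective f -> row_free A -> row_free (rowsub f A).
Proof.
move=> inj_f /row_freeP[B AB]; apply/row_freeP; exists (B *m (rowsub f 1%:M)^T).
rewrite mulmxA mul_rowsub_mx AB; apply/matrixP=> i j; rewrite !mxE.
rewrite (bigD1 (f j)) //= big1 => [|k /negPf neq_k].
  by rewrite !mxE eqxx mulr1 addr0 (inj_eq inj_f).
by rewrite !mxE (eq_sym (f j)) neq_k mulr0.
Qed.

(** A nonzero minor is an invertible submatrix, whose rank is at most that of [A]. Conversely, if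
    the rank is at least [r], then [r] rows of a maximal free family, followed by a choice of [r]
    columns, give a nonzero minor. *)
Lemma minors_eq0P m n r (A : 'M[F]_(m, n)) :
  (forall (f : 'I_r -> 'I_m) (g : 'I_r -> 'I_n), \det (mxsub f g A) = 0)
  <-> (\rank A < r)%N.
Proof.
split=> [minor0 | ltAr f g]; last first.
  apply/eqP; apply: contraLR ltAr; rewrite -leqNgt -unitfE -unitmxE.
  by move=> /mxrank_unit {1}<-; apply: mxrank_mxsub.
rewrite ltnNge; apply/negP => le_rA.
pose f := maxrankfun A \o widen_ord le_rA.
have fullA : row_full (rowsub f A)^T.
  rewrite -[row_full _]/(_ == _) mxrank_tr -[_ == _]/(row_free _) rowsub_comp.
  apply: rowsub_free (maxrowsub_free A) => i j /(congr1 val) /= eq_ij.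
  exact: val_inj.
have := fullrowsub_unit fullA; rewrite unitmxE unitfE -det_tr.
rewrite -[X in \det X](_ : mxsub f (fullrankfun fullA) A = _).
  by rewrite minor0 eqxx.
by apply/matrixP=> i j; rewrite !mxE.
Qed.

End Minors.

(** * Pencils of binary forms are not generically injective *)

Section Pencil.
Variables (K : closedFieldType) (charK0 : [pchar K] =i pred0).

(** The coefficients of the derivative are those of [p] times positive integers, which are
    invertible in characteristic 0. *)
Lemma deriv_eq0_size (p : {poly K}) : p^`() = 0 -> (size p <= 1)%N.
Proof.
move=> dp0; apply/leq_sizeP => -[//|i] _; have /polyP/(_ i) := dp0.
rewrite coef_deriv coef0 -mulr_natr => /eqP; rewrite mulf_eq0.
by have /pcharf0P-> := charK0; rewrite orbF => /eqP.
Qed.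

(** By coprimality [p] divides its own derivative, which for reasons of degree must be zero. *)
Lemma coprime_wronskian (p q : {poly K}) :
  coprimep p q -> p * q^`() = p^`() * q -> (size p <= 1)%N.
Proof.
move=> co_pq eqpq; apply: deriv_eq0_size; apply/eqP; apply: contraT => nz_dp.
have p_dp : p %| p^`() by rewrite -(Gauss_dvdpl _ co_pq) -eqpq dvdp_mulr.
have nz_p : p != 0 by apply: contraNneq nz_dp => ->; rewrite deriv0.
by have := dvdp_leq nz_dp p_dp; rewrite leqNgt lt_size_deriv.
Qed.

Lemma coprime_no_common_root (p q : {poly K}) :
  (forall x, ~~ (root p x && root q x)) -> coprimep p q.
Proof.
move=> no_root; rewrite /coprimep; apply: contraT => /closed_rootP[x].
by rewrite root_gcd (negPf (no_root x)).
Qed.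

(** After ['X - x] is split off, the cofactor is not constant and so has a root; this root can only
    be [x] again. *)
Lemma single_root_double (p : {poly K}) x : (2 < size p)%N ->
  (forall y, root p y -> y = x) -> p^`().[x] = 0.
Proof.
move=> size_p px; have /closed_rootP[y] : size p != 1%N.
  by case: size size_p => [|[]].
move=> py; have := py; rewrite (px y py) => /factor_theorem[q def_p].
have nz_q : q != 0.
  by apply: contraTneq size_p => q0; rewrite def_p q0 mul0r size_poly0.
have size_q : size q != 1%N.
  apply: contraTneq size_p => q1.
  by rewrite def_p size_Mmonic ?monicXsubC // size_XsubC q1.
have /closed_rootP[z qz] := size_q.
have eq_z : z = x by apply: px; rewrite def_p rootM qz.
move: qz; rewrite eq_z => /rootP qx.
by rewrite def_p derivM hornerD !hornerM qx hornerXsubC subrr mul0r mulr0 addr0.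
Qed.

Variables (n : nat) (b : 'M[K]_(2, n.+1)).
Let g (p : 'rV[K]_2) : 'rV[K]_2 := veronese n p *m b^T.
Let G i := rVpoly (row i b).

Lemma map_coordE i p : g p 0 i = (form (row i b)).@[p 0].
Proof.
rewrite form_veronese mxE [RHS]mxE; apply: eq_bigr => l _.
by rewrite !mxE mulrC.
Qed.

Definition infty : 'rV[K]_2 := delta_mx 0 1.

Lemma infty_neq0 : infty != 0.
Proof. by apply/eqP => /rowP/(_ 1)/eqP; rewrite !mxE !eqxx oner_eq0. Qed.

Lemma affine_point_infty x : (affine_point x == infty)%MS = false.
Proof.
apply/negP; rewrite -point_form_eq0 ?affine_point_neq0 ?infty_neq0 //.
by rewrite point_formE !mxE /= expr0 expr1 mulr1 mul0r subr0 oner_eq0.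
Qed.

Lemma map_coord_infty i : g infty 0 i = b i ord_max.
Proof.
rewrite map_coordE formE (bigD1 ord_max) //= big1 => [|l neq_l].
  by rewrite !mxE subnn expr0 expr1n !mul1r mulr1 addr0.
rewrite !mxE /= expr0n subn_eq0 leqNgt (_ : (l < n)%N) ?mul0r ?mulr0 //.
by rewrite ltn_neqAle -ltnS ltn_ord andbT; apply: neq_l.
Qed.

(* If g is injective over the open set h <> 0, then the member
   g_0(x) g_1 - g_1(x) g_0 of the pencil has the single, multiple, root x; so
   the Wronskian vanishes identically. *)
Lemma pencil_not_injective (h : {poly K}) : (1 < n)%N -> h != 0 ->
  (forall p, p != 0 -> g p != 0) ->
  (forall x q, h.[x] != 0 -> q != 0 -> (g (affine_point x) == g q)%MS ->
    (affine_point x == q)%MS) -> False.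
Proof.
move=> n_gt1 nz_h nz_g g_inj.
have nz_gx x : g (affine_point x) != 0 by rewrite nz_g ?affine_point_neq0.
have gE i x : g (affine_point x) 0 i = (G i).[x].
  by rewrite map_coordE form_affine.
have wronskian0 : (G 0) * (G 1)^`() - (G 1) * (G 0)^`() = 0.
  apply: (poly_vanish_outside nz_h) => x hx.
  pose D := (G 0).[x] *: G 1 - (G 1).[x] *: G 0.
  (* The coefficient of t^n in [D] vanishes only if [g] takes the same value at [x] and at infinity,
     which injectivity excludes. *)
  have size_D : size D = n.+1.
    have D_row : D = rVpoly ((G 0).[x] *: row 1 b - (G 1).[x] *: row 0 b).
      rewrite linearB [X in X - _]linearZ [X in _ - X]linearZ. by [].
    apply/eqP; rewrite eqn_leq {1}D_row size_poly /=.
    rewrite ltnNge; apply/negP => /leq_sizeP/(_ n (leqnn _)).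
    rewrite D_row coef_rVpoly insubT // => lt_n.
    rewrite !mxE (_ : Sub n lt_n = ord_max); last exact: val_inj.
    rewrite -!map_coord_infty -!gE => /eqP D0.
    have := g_inj x infty hx infty_neq0; rewrite affine_point_infty.
    rewrite -(point_form_eq0 (nz_g _ infty_neq0) (nz_gx x)) point_formE.
    by rewrite (mulrC (g infty 0 1)) (mulrC (g infty 0 0)) D0 => /(_ isT).
  have := @single_root_double D x; rewrite size_D => /(_ n_gt1) D'0.
  rewrite -[RHS]D'0 => [|y /rootP Dy].
    by rewrite derivB !derivZ !hornerE.
  (* A root [y] of [D] is a point with the same image as [x]. *)
  apply: affine_point_inj; rewrite andbC; apply: g_inj; first exact: hx.
    exact: affine_point_neq0.
  rewrite -(point_form_eq0 (nz_gx y) (nz_gx x)) point_formE !gE.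
  by rewrite (mulrC (G 1).[y]) (mulrC (G 0).[y]) -Dy !hornerE.
have co_G : coprimep (G 0) (G 1).
  apply: coprime_no_common_root => x; apply: contra (nz_gx x).
  case/andP=> /rootP x0 /rootP x1; apply: contraT => /rV2_neq0.
  by rewrite !gE x0 x1 eqxx.
have size0 : (size (G 0%R) <= 1)%N.
  apply: (coprime_wronskian co_G); apply/eqP.
  by rewrite -subr_eq0 (mulrC _^`()) wronskian0.
have size1 : (size (G 1%R) <= 1)%N.
  apply: (@coprime_wronskian _ (G 0)); first by rewrite coprimep_sym.
  by apply/eqP; rewrite eq_sym -subr_eq0 mulrC wronskian0.
(* Both coordinates are constant in the chart, so their coefficients of t^n, which are their values
   at infinity, vanish. *)
have /rV2_neq0 := nz_g _ infty_neq0; rewrite !map_coord_infty.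
have bE i : b i ord_max = (G i)`_n.
  rewrite coef_rVpoly insubT // => lt_n; rewrite mxE; congr (b i _).
  exact: val_inj.
by rewrite !bE !nth_default ?eqxx // (leq_trans _ (ltnW n_gt1)).
Qed.
End Pencil.

(** * Rank counts for the matrix M_k *)

Section Core.
Variable K : closedFieldType.

Lemma comp_homog m k d e (F : {mpoly K[k]}) (x : k.-tuple {mpoly K[m]}) :
  F \is d.-homog -> (forall i, tnth x i \is e.-homog) ->
  F \mPo x \is (e * d).-homog.
Proof.
move=> /dhomogP homF homx; rewrite comp_mpolyE big_seq.
apply: rpred_sum => mon /homF /=; rewrite mdegE => <-; apply: rpredZ.
rewrite big_distrr /=.
apply: (big_ind2 (fun (p : {mpoly K[m]}) l => p \is l.-homog)) => [||i _].
- exact: dhomog1.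
- by move=> *; apply: dhomogM.
- by apply: dhomogMn.
Qed.

Lemma param_comp n (a : 'M[K]_(3, n.+1)) (F : {mpoly K[3]}) (p : 'rV[K]_2) :
  F.@[param a p 0] = (F \mPo [tuple form (row u a) | u < 3]).@[p 0].
Proof.
rewrite comp_mpoly_meval; apply: meval_eq => u.
by rewrite tnth_mktuple mxE.
Qed.

(** With rank at most 2, the parameterization factors through a pencil [b], which inherits from it
    both the absence of base points and generic injectivity. *)
Lemma param_rank n (a : 'M[K]_(3, n.+1)) : [pchar K] =i pred0 -> (1 < n)%N ->
  proper_param a -> (2 < \rank a)%N.
Proof.
move=> charK0 n_gt1 [nz_f [d [F [homF [p nzp Fp0] F_inj]]]].
rewrite ltnNge; apply/negP => rank_a.
have [b [C def_a]] : exists (b : 'M_(2, n.+1)) (C : 'M_(3, 2)), a = C *m b.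
  exists (pid_mx (\rank a) *m row_ebase a), (col_ebase a *m pid_mx (\rank a)).
  rewrite -{1}[a]mulmx_ebase mulmxA; congr (_ *m _).
  by rewrite -mulmxA mul_pid_mx minnn (minn_idPr rank_a).
have fE q : param a q = (veronese n q *m b^T) *m C^T.
  by rewrite -proj_veronese /proj def_a trmx_mul mulmxA.
(* The pullback of [F] to P^1; its restriction to the chart is the polynomial [h] needed for the
   pencil, nonzero because [Phi] does not vanish at [p]. *)
pose Phi := F \mPo [tuple form (row u a) | u < 3].
have [c def_Phi] : exists c : 'rV[K]_(n * d).+1, Phi = form c.
  apply/homog_form/comp_homog => // u.
  by rewrite tnth_mktuple form_homog.
have hE x : (rVpoly c).[x] = F.@[param a (affine_point x) 0].
  by rewrite param_comp -/Phi def_Phi form_affine.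
apply: (pencil_not_injective charK0 (b := b) (h := rVpoly c)) => //.
- apply: contraNneq Fp0 => c0.
  by rewrite param_comp -/Phi def_Phi -[c]rVpolyK c0 linear0 form0 meval0.
- move=> q /nz_f; apply: contra => /eqP q0.
  by rewrite fE q0 mul0mx.
move=> x q; rewrite hE => hx nzq; case/andP=> gxq gqx.
apply: F_inj => //; first exact: affine_point_neq0.
by rewrite !fE; apply/andP; split; apply: submxMr.
Qed.

Variables (n : nat) (a : 'M[K]_(3, n.+1)).

Lemma ZP k (R : 'rV[K]_k.+1) :
  Z a R <-> R != 0 /\ (\rank (col_mx (band n R) a) < n - k + 3)%N.
Proof. by split=> -[nzR /minors_eq0P]. Qed.

Variables (P : 'rV[K]_3) (nzP : P != 0).

(** The columns of the cokernel of [P] are, once transposed, orthogonal to [P]; that [x] kills them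
    all means that it lies in the row space of [P]. *)
Lemma perp_submx (x : 'rV[K]_3) :
  (forall u : 'rV_3, u *m P^T = 0 -> u *m x^T = 0) -> (x <= P)%MS.
Proof.
move=> perp_x; rewrite submxE -trmx_eq0 trmx_mul.
apply/eqP/row_matrixP => i; rewrite row0 row_mul perp_x //.
by rewrite -row_mul -trmx_mul mulmx_coker trmx0 row0.
Qed.

Lemma mxrank_perp : \rank (kermx P^T) = 2.
Proof. by rewrite mxrank_ker mxrank_tr rank_rV nzP. Qed.

Lemma Z_perp_dvd k (R : 'rV[K]_k.+1) : (k <= n)%N -> Z a R ->
  is_proj_span a R P ->
  forall u : 'rV_3, u *m P^T = 0 -> mdvd (form R) (form (u *m a)).
Proof.
move=> le_kn /ZP[nzR rankM] [_ /(_ P nzP)[_ /(_ _)]].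
case=> [|z [[_ spanz] _ /andP[_ Pz]] u uP0]; first by rewrite submx_refl.
pose M := col_mx (band n R) a.
(* Each relation between the rows of [M] splits into a multiple of G_R, from [X], and a combination
   of f_0, f_1, f_2, from [Y]. *)
pose X := lsubmx (kermx M); pose Y := rsubmx (kermx M).
have XY0 : X *m band n R + Y *m a = 0.
  by rewrite -mul_row_col hsubmxK mulmx_ker.
have YE : Y *m a = - (X *m band n R) by rewrite (addr0_eq XY0).
(* A relation with zero [Y] part is trivial, since the rows of [band n R] are independent. So [Y]
   has at least the rank of [kermx M], which is at least (n - k + 4) - (n - k + 2) = 2. *)
have kerY : (kermx Y <= kermx (kermx M))%MS.
  apply/sub_kermxP; rewrite -[kermx M]hsubmxK mul_mx_row -/X -/Y mulmx_ker.
  suff -> : kermx Y *m X = 0 by rewrite row_mx0.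
  apply: (row_free_inj (band_free le_kn nzR)); rewrite mul0mx -mulmxA.
  by rewrite -[X *m _]opprK -YE mulmxN mulmxA mulmx_ker mul0mx oppr0.
have rankY : (2 <= \rank Y)%N.
  have := mxrankS kerY; rewrite !mxrank_ker.
  by move: (rank_leq_col Y) rankM; rewrite -/M; lia.
(* [P] is the image of a point [z] of H_R; the multiples of G_R vanish on [z], and [Y *m a] consists
   of such multiples. *)
have Y_perp : (Y <= kermx P^T)%MS.
  apply/sub_kermxP; case/sub_rVP: Pz => c ->.
  rewrite linearZ /= -scalemxAr trmx_mul trmxK mulmxA.
  suff bandz : band n R *m z^T = 0.
    by rewrite YE mulNmx -mulmxA bandz mulmx0 oppr0 scaler0.
  apply/row_matrixP => i; rewrite row_mul row0; apply/rowP => j.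
  rewrite [j]ord1 !mxE -[RHS](spanz (row i (band n R))).
    by apply: eq_bigr => l _; rewrite !mxE.
  by apply/mdvd_formP; rewrite ?row_sub.
have perp_Y : (kermx P^T <= Y)%MS.
  by rewrite -(mxrank_leqif_sup Y_perp) eqn_leq mxrankS //= mxrank_perp.
have /submxP[w ->] : (u <= Y)%MS.
  by apply: submx_trans perp_Y; apply/sub_kermxP.
apply/mdvd_formP => //; rewrite -mulmxA YE.
by rewrite mulmxN mulmxA -mulNmx submxMl.
Qed.

Lemma perp_not_all_dvd k (R : 'rV[K]_k.+1) (p : 'rV[K]_2) :
  [pchar K] =i pred0 -> (1 < n)%N -> proper_param a ->
  (k < n)%N -> Z a R -> ~ Z' a R -> p != 0 ->
  ~ (forall u : 'rV_3, u *m P^T = 0 ->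
       mdvd (point_form p * form R) (form (u *m a))).
Proof.
move=> charK0 n_gt1 a_proper lt_kn ZR Z'R nzp dvd_all.
have nzR : R != 0 by case: ZR.
have [Rt def_Rt] : exists Rt : 'rV[K]_k.+2, point_form p * form R = form Rt.
  by apply: homog_form; apply: dhomogM (point_form_homog p) (form_homog R).
have nzRt : Rt != 0.
  apply/eqP => Rt0; have /eqP := def_Rt.
  rewrite Rt0 form0 mulf_eq0.
  rewrite (negPf (point_form_neq0 nzp)) /= => /eqP/form_eq0 R0.
  by rewrite R0 eqxx in nzR.
have perp_band : (kermx P^T *m a <= band n Rt)%MS.
  apply/row_subP => i; rewrite row_mul; apply/mdvd_formP => //.
  rewrite -def_Rt; apply: dvd_all.
  by rewrite -row_mul mulmx_ker row0.
(* The plane orthogonal to [P] contributes nothing beyond [band n Rt], which has [(n - k.+1).+1]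
   rows; a complementary line adds at most 1. *)
have rank_sum : (\rank (col_mx (band n Rt) a) <= n - k.+1 + 2)%N.
  have a_sub : (a <= band n Rt + (kermx P^T)^C *m a)%MS.
    rewrite -{1}[a]mul1mx.
    have: (1%:M *m a <= (kermx P^T + (kermx P^T)^C)%MS *m a)%MS.
      by rewrite submxMr // sub1mx addsmx_compl_full.
    move/submx_trans; apply; rewrite addsmxMr addsmxS //.
  have := mxrankS (_ :
    (col_mx (band n Rt) a <= band n Rt + (kermx P^T)^C *m a)%MS).
  rewrite -addsmxE addsmx_sub addsmxSl a_sub => /(_ isT) le_rank.
  have := mxrank_sum_cap (band n Rt) ((kermx P^T)^C *m a)%MS.
  move: (rank_leq_row (band n Rt)) (mxrankM_maxl (kermx P^T)^C%MS a).
  by rewrite mxrank_compl mxrank_perp; lia.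
have [le_k2n|] := leqP k.+2 n.
  apply: Z'R; split=> //; exists Rt; split.
    by apply/ZP; split=> //; rewrite (leq_ltn_trans rank_sum) // ltn_add2l.
  exists (point_form p); first exact: point_form_homog.
  by exists 1; rewrite ?oner_eq0 // scale1r def_Rt.
(* Now k = n - 1, and the bound says that [a] has rank at most 2. *)
rewrite ltnS => le_nk.
have := param_rank charK0 n_gt1 a_proper; apply/negP; rewrite -leqNgt.
apply: leq_trans (leq_trans rank_sum _).
  by apply: mxrankS; rewrite -addsmxE addsmxSr.
by rewrite (eqP (_ : n - k.+1 == 0)%N) // subn_eq0.
Qed.

End Core.

(** * Merging two parts of a partition *)

Section Partitions.

Lemma sorted_geq_gt0 (s : seq nat) i :
  sorted geq s -> (i < count (ltn 0) s)%N = (0 < nth 0 s i)%N.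
Proof.
elim: s i => [|x s IHs] i /=; first by rewrite nth_nil.
rewrite path_sortedE => [/andP[/allP s_le /IHs s_gt0]|]; last first.
  by move=> y z t /= yz ty; apply: leq_trans yz.
case: x s_le => [s0|x _]; last by case: i => //= i; rewrite add1n ltnS.
rewrite add0n; have all0 y : y \in s -> y = 0%N.
  by move/s0; rewrite /= leqn0 => /eqP.
rewrite (_ : count (ltn 0) s = 0%N); last first.
  by apply/eqP; rewrite -leqn0 leqNgt -has_count; apply/hasPn => y /all0->.
case: i => //= i; have [lt_i|le_s] := ltnP i (size s).
  by rewrite (all0 _ (mem_nth 0%N lt_i)).
by rewrite nth_default.
Qed.

Lemma count_tuple k (b : pred nat) (l : k.-tuple nat) :
  (count b l = \sum_(x < k) b (tnth l x))%N.
Proof.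
rewrite -[LHS]sum1_count big_tuple big_mkcond.
by apply: eq_bigr => x _; case: (b _).
Qed.

Lemma sumn_tuple k (l : k.-tuple nat) : (sumn l = \sum_(x < k) tnth l x)%N.
Proof. by rewrite sumnE big_tuple. Qed.

Section Merge.
Variables (k : nat) (l : k.-tuple nat) (i i' : 'I_k).
Hypothesis neq_i : i' != i.

(** Position [i'] is kept as a zero so that the length remains [k]; the result need not be
    sorted. *)
Definition merge_part : k.-tuple nat :=
  [tuple if x == i then tnth l i + tnth l i' else
         if x == i' then 0 else tnth l x | x < k]%N.

Lemma tnth_merge x : tnth merge_part x =
  (if x == i then tnth l i + tnth l i' else if x == i' then 0 else tnth l x)%N.
Proof. by rewrite tnth_mktuple. Qed.

(** Stated for a general operation because it serves for the sum of the parts, for their count and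
    for products of powers of forms. *)
Lemma big_merge (T : Type) (idx : T) (op : Monoid.com_law idx)
    (F : 'I_k -> nat -> T) :
  \big[op/idx]_x F x (tnth merge_part x) =
  op (F i (tnth l i + tnth l i')%N) (op (F i' 0)
    (\big[op/idx]_(x | (x != i) && (x != i')) F x (tnth l x))).
Proof.
rewrite (bigD1 i) //= (bigD1 i') //= !tnth_merge eqxx (negPf neq_i) eqxx.
congr (op _ (op _ _)); apply: eq_bigr => x /andP[/negPf neq_xi /negPf neq_xi'].
by rewrite tnth_merge neq_xi neq_xi'.
Qed.

Lemma big_split2 (T : Type) (idx : T) (op : Monoid.com_law idx)
    (F : 'I_k -> T) :
  \big[op/idx]_x F x =
  op (F i) (op (F i') (\big[op/idx]_(x | (x != i) && (x != i')) F x)).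
Proof. by rewrite (bigD1 i) //= (bigD1 i'). Qed.

Lemma sumn_merge : sumn merge_part = sumn l.
Proof.
rewrite !sumn_tuple (big_merge _ (fun _ y => y)) big_split2 /=.
by rewrite add0n addnA.
Qed.

Lemma count_merge : (0 < tnth l i)%N -> (0 < tnth l i')%N ->
  (count (ltn 0) merge_part).+1 = count (ltn 0) l.
Proof.
move=> li li'; rewrite !count_tuple (big_merge _ (fun _ y => (0 < y) : nat)%N).
by rewrite [RHS]big_split2 /= addn_gt0 li li'.
Qed.

Lemma merge_refines (l' : k.-tuple nat) : perm_eq l' merge_part -> refines l' l.
Proof.
case/tuple_permP => s def_l'.
have l'E x : tnth l' x = tnth merge_part (s x).
  by rewrite (_ : l' = [tuple tnth merge_part (s x) | x < k]) ?tnth_mktuple //;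
    apply: val_inj.
(* The merged part is split back into its two summands; the zero left at [i'] is removed by the
   filter. *)
pose split_part y :=
  if y == i then [:: tnth l i; tnth l i'] else [:: tnth merge_part y].
exists (fun x => split_part (s x)); split=> [x|].
  rewrite l'E /split_part; case: eqP => [->|_] /=; last by rewrite addn0.
  by rewrite tnth_merge eqxx addn0.
apply/seq.permP => b; rewrite !count_filter.
set b' := predI _ _.
rewrite count_flatten -map_comp sumnE big_map big_enum /=.
have -> : (\sum_x count b' (split_part (s x)) =
           \sum_y count b' (split_part y))%N.
  by rewrite [RHS](reindex_perm s).
rewrite count_tuple.
rewrite big_split2 [RHS]big_split2 /split_part eqxx (negPf neq_i) /=.
rewrite !addn0 tnth_merge eqxx (negPf neq_i) ltnn andbF add0n addnA.
congr (_ + _)%N.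
apply: eq_bigr => y /andP[/negPf neq_yi /negPf neq_yi'].
by rewrite neq_yi /= addn0 tnth_merge neq_yi neq_yi'.
Qed.

End Merge.

End Partitions.

(** * Distinct roots from the minimal partition *)

Section Factorization.
Variable K : closedFieldType.

Lemma in_stratum_points k (l : k.-tuple nat) (R : 'rV[K]_k.+1) :
  in_stratum l R -> exists q : 'I_k -> 'rV[K]_2, (forall i, q i != 0) /\
    proportional (form R) (\prod_i point_form (q i) ^+ tnth l i).
Proof.
case=> nzR [L [homL [c nz_c def_R]]].
have nzL i : (0 < tnth l i)%N -> L i != 0.
  move=> li; apply: contraNneq nzR => Li0; apply/eqP/form_eq0.
  rewrite def_R (bigD1 i) //= Li0 expr0n -[_ == _]negbK -lt0n li.
  by rewrite mul0r scaler0.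
have /fin_all_exists[q qP] i : exists Q : 'rV[K]_2,
    Q != 0 /\ L i ^+ tnth l i = point_form Q ^+ tnth l i.
  have [li|] := ltnP 0 (tnth l i).
    by have [Q nzQ ->] := linear_form_point (homL i) (nzL i li); exists Q.
  (* With exponent 0 the factor is 1 whatever the form, which may even be zero, so any point will
     do. *)
  rewrite leqn0 => /eqP->; exists (affine_point 0).
  by rewrite affine_point_neq0 !expr0.
exists q; split=> [i|]; first by case: (qP i).
exists c => //; rewrite def_R; congr (_ *: _).
by apply: eq_bigr => i _; case: (qP i).
Qed.

(** If two positive parts belonged to the same root, merging them would give a strictly coarser
    partition whose stratum still contains [R]. *)
Lemma minimal_partn_points k (l : k.-tuple nat) (R : 'rV[K]_k.+1) :
  minimal_partn R l -> exists q : 'I_k -> 'rV[K]_2,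
    [/\ forall i, q i != 0,
        proportional (form R) (\prod_i point_form (q i) ^+ tnth l i)
      & forall i i', (0 < tnth l i)%N -> (0 < tnth l i')%N ->
          (q i == q i')%MS -> i = i'].
Proof.
case=> -[sort_l sum_l] strat_l min_l.
have nzR : R != 0 by case: strat_l.
have [q [nz_q [c nz_c def_R]]] := in_stratum_points strat_l.
exists q; split=> // [|i i' li li' eq_q]; first by exists c.
apply/eqP; rewrite eq_sym; apply: contraT => neq_i.
have [e eq_pf] : exists e, point_form (q i') = e *: point_form (q i).
  by apply: point_form_eqmx; rewrite andbC.
pose m := merge_part l i i'; pose l' := [tuple of sort geq m].
have perm_l' : perm_eq l' m by rewrite perm_sort.
(* Equality is absurd: merging lowers the number of positive parts by one. *)
suff eq_l : l' = l.
  have := count_merge neq_i li li'; rewrite -{2}eq_l (seq.permP perm_l').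
  by move/eqP; rewrite -[X in _ == X]addn0 -addn1 eqn_add2l.
apply: min_l; last exact: merge_refines perm_l'.
  split; last by rewrite (perm_sumn perm_l') sumn_merge.
  by apply: sort_sorted => x y; apply: leq_total.
split=> //; case/tuple_permP: (perm_l') => s def_l'.
have l'E x : tnth l' x = tnth m (s x).
  by rewrite (_ : l' = [tuple tnth m (s x) | x < k]) ?tnth_mktuple //;
    apply: val_inj.
exists (fun x => point_form (q (s x))); split=> [x|].
  exact: point_form_homog.
(* The two point forms agree only up to the scalar [e], which enters once for each factor moved from
   [i'] to [i]. *)
have eq_R : form R = (c * e ^+ tnth l i') *:
    \prod_x point_form (q (s x)) ^+ tnth l' x.
  under eq_bigr do rewrite l'E.
  have -> : \prod_x point_form (q (s x)) ^+ tnth m (s x) =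
      \prod_y point_form (q y) ^+ tnth m y by rewrite [RHS](reindex_perm s).
  rewrite (big_merge l neq_i _ (fun y d => point_form (q y) ^+ d)) /=.
  rewrite def_R (big_split2 neq_i) /= expr0 mul1r exprD eq_pf exprZn.
  by rewrite -scalerA -scalerAl -scalerAr mulrA.
exists (c * e ^+ tnth l i') => //.
apply: contraNneq nzR => ce0; apply/eqP/form_eq0.
by rewrite eq_R ce0 scale0r.
Qed.

End Factorization.

(** * The preimage of P through the lines containing P *)

Section Preimage.
Variables (K : closedFieldType) (n : nat) (a : 'M[K]_(3, n.+1)).

Lemma mdvd_mul_point_form (p : 'rV[K]_2) (G r : {mpoly K[2]}) d :
  p != 0 -> r \is d.-homog -> r.@[p 0] = 0 -> mdvd (point_form p * G) (r * G).
Proof.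
move=> nzp homr rp0; have [s ->] := point_form_dvd nzp homr rp0.
by exists s; rewrite mulrA.
Qed.

Lemma form_param (u : 'rV[K]_3) (p : 'rV[K]_2) :
  (form (u *m a)).@[p 0] = (u *m (param a p)^T) 0 0.
Proof. by rewrite form_veronese -proj_veronese trmx_mul trmxK mulmxA. Qed.

Lemma perp_paramP (P : 'rV[K]_3) (p : 'rV[K]_2) :
  P != 0 -> param a p != 0 ->
  (param a p == P)%MS <->
  (forall u : 'rV_3, u *m P^T = 0 -> (form (u *m a)).@[p 0] = 0).
Proof.
move=> nzP nzf; split=> [/andP[/sub_rVP[c def_f] _] u uP0|perp0].
  by rewrite form_param def_f linearZ /= -scalemxAr uP0 scaler0 mxE.
apply: row_eqmx => //; apply: perp_submx => u /perp0.
rewrite form_param => uf0; apply/rowP => i; rewrite ord1 uf0 mxE //.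
Qed.

(** The homogeneous ideal of [P] is generated by the linear forms [u] orthogonal to [P], so these
    alone decide the multiplicity. *)
Lemma preimage_geP (P : 'rV[K]_3) (Q : 'rV[K]_2) m : P != 0 ->
  preimage_ge a P Q m <->
  (forall u : 'rV_3, u *m P^T = 0 -> mdvd (point_form Q ^+ m) (form (u *m a))).
Proof.
move=> nzP; split=> [geQ u uP0|dvdQ d F homF FP0].
  have -> : form (u *m a) =
      (\sum_v u 0 v *: 'X_v) \mPo [tuple form (row v a) | v < 3].
    rewrite form_mulmx raddf_sum; apply: eq_bigr => v _.
    by rewrite /= comp_mpolyZ comp_mpolyXU -tnth_nth tnth_mktuple.
  apply: (geQ 1%N).
    by apply: rpred_sum => v _; apply: rpredZ; rewrite dhomogX /= mdeg1.
  have /rowP/(_ 0) := uP0; rewrite !mxE raddf_sum => {2}<-.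
  by apply: eq_bigr => v _; rewrite /= mevalZ mevalXU mxE.
have [w nzPw] : exists w, P 0 w != 0.
  apply/existsP; apply: contraNT nzP; rewrite negb_exists => /forallP P0.
  by apply/eqP/rowP => v; rewrite mxE; apply/eqP; have := P0 v; rewrite negbK.
apply: (mdvd_homog_comp (y := (P 0 w)^-1 *: form (row w a)) homF FP0) => v.
(* Divisibility for this [u] says that f_v is congruent to [P 0 v] times f_w / [P 0 w], so that f is
   congruent to a multiple of [P]. *)
pose u : 'rV[K]_3 := delta_mx 0 v - (P 0 v / P 0 w) *: delta_mx 0 w.
have -> : tnth [tuple form (row v a) | v < 3] v
    - P 0 v *: ((P 0 w)^-1 *: form (row w a)) = form (u *m a).
  by rewrite tnth_mktuple scalerA -formZ -form_sub mulmxBl -scalemxAl !rowE.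
apply: dvdQ; rewrite mulmxBl -scalemxAl; apply/rowP => i.
rewrite -!rowE !mxE ord1.
by rewrite divfK ?subrr.
Qed.

End Preimage.

Theorem corollary3p15 (K : closedFieldType) (charK0 : [pchar K] =i pred0)
    (n : nat) (n_ge3 : (3 <= n)%N) (a : 'M[K]_(3, n.+1)) (a_proper : proper_param a)
    (j : nat) (j_bounds : (2 <= j <= n.-1)%N)
    (R : 'rV[K]_j.+1) (RZ : Z a R) (RZ' : ~ Z' a R)
    (lambda : j.-tuple nat) (lambdaP : minimal_partn R lambda)
    (P : 'rV[K]_3) (PP : is_proj_span a R P) :
  exists Q : 'I_(partn_length lambda) -> 'rV[K]_2,
    branches a P Q /\
    forall i, branch_mult a P (Q i) (nth 0%N lambda i).
Proof.
have lt_jn : (j < n)%N by lia.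
have le_jn := ltnW lt_jn.
have nzP : P != 0 by case: PP.
have nz_f : forall p, p != 0 -> param a p != 0 by case: a_proper.
have perp_dvd := Z_perp_dvd nzP le_jn RZ PP.
have not_all p : p != 0 -> ~ (forall u : 'rV_3, u *m P^T = 0 ->
    mdvd (point_form p * form R) (form (u *m a))).
  exact: (perp_not_all_dvd nzP charK0 (ltnW n_ge3) a_proper lt_jn RZ RZ').
have [q [nz_q [c nz_c def_R] inj_q]] := minimal_partn_points lambdaP.
have quotient u : u *m P^T = 0 ->
    exists2 r, r \is (n - j).-homog & form (u *m a) = r * form R.
  move=> uP0; apply: mdvd_homogP (perp_dvd u uP0) => //; exact: form_homog.
have sort_l : sorted geq lambda by case: lambdaP => -[].
have le_len : (partn_length lambda <= j)%N.
  by rewrite -{2}(size_tuple lambda) count_size.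
(* As [lambda] is sorted, its positive parts sit at the first [partn_length lambda] positions; the
   branches are the roots at these positions. *)
pose w := widen_ord le_len.
have w_gt0 i : (0 < tnth lambda (w i))%N.
  by rewrite (tnth_nth 0%N) -sorted_geq_gt0 //; exact: (ltn_ord i).
have R_Q i (p : 'rV_2) : p != 0 -> (p == q (w i))%MS -> (form R).@[p 0] = 0.
  move=> nzp; rewrite -(point_form_eq0 (nz_q (w i)) nzp) => /eqP pf0.
  rewrite def_R mevalZ (bigD1 (w i)) //= mevalM rmorphXn /= pf0.
  by rewrite expr0n eqn0Ngt w_gt0 mul0r mulr0.
exists (q \o w); split; first split=> /=.
- by move=> i; apply: nz_q.
- move=> i i' /inj_q eq_i; apply: val_inj.
  by have /(congr1 val) := eq_i (w_gt0 i) (w_gt0 i').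
- move=> p nzp; rewrite proj_veronese; split=> [fp|[i eq_p]].
    (* If [p] lies over [P] but is no root of G_R, then all the cofactors [r] vanish at [p], which
       [not_all] forbids. *)
    have [Rp0|nzRp] := eqVneq (form R).@[p 0] 0; last first.
      case: (not_all p nzp) => u uP0; have [r homr def_u] := quotient u uP0.
      rewrite def_u; apply: mdvd_mul_point_form (homr) _ => //.
      have /(perp_paramP nzP (nz_f p nzp))/(_ u uP0)/eqP := fp.
      by rewrite def_u mevalM mulf_eq0 (negPf nzRp) orbF => /eqP.
    move/eqP: Rp0; rewrite def_R mevalZ mulf_eq0 (negPf nz_c) rmorph_prod /=.
    case/prodf_eq0 => x _; rewrite rmorphXn /= expf_eq0 point_form_eq0 //.
    case/andP=> lx eq_p; have lt_x : (x < partn_length lambda)%N.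
      by rewrite /partn_length sorted_geq_gt0 // -tnth_nth.
    exists (Ordinal lt_x); rewrite (_ : w _ = x) //; exact: val_inj.
  apply/(perp_paramP nzP (nz_f p nzp)) => u /perp_dvd /mdvd_meval0; apply.
  exact: (R_Q i p).
move=> i /=; rewrite -[i : nat]/(w i : nat) -tnth_nth.
set M := \prod_(x | x != w i) point_form (q x) ^+ tnth lambda x.
have RM : form R = (c *: M) * point_form (q (w i)) ^+ tnth lambda (w i).
  by rewrite def_R (bigD1 (w i)) //= -/M -scalerAl mulrC.
have MQ : (c *: M).@[q (w i) 0] != 0.
  rewrite mevalZ mulf_neq0 // rmorph_prod; apply/prodf_neq0 => x neq_x /=.
  rewrite rmorphXn /= expf_eq0 negb_and.
  have [lx|//] := ltnP 0 (tnth lambda x); rewrite /= point_form_eq0 //.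
  apply: contra neq_x => eq_q.
  by apply/eqP/esym/inj_q.
split; first apply/preimage_geP => // u uP0.
  by apply: mdvd_trans (perp_dvd u uP0); exists (c *: M).
move/(preimage_geP _ _ _ nzP) => dvdS; apply: (not_all _ (nz_q (w i))) => u uP0.
have [r homr def_u] := quotient u uP0; rewrite def_u.
apply: mdvd_mul_point_form (homr) _ => //.
(* Cancelling the common power of the point form leaves [r] times [c *: M] divisible by one more
   factor; since [c *: M] is nonzero at the point, [r] vanishes there. *)
have [s] := dvdS u uP0; rewrite def_u RM exprS !mulrA => /mulIf.
rewrite expf_neq0 ?point_form_neq0 // => /(_ isT) /(congr1 (meval (q (w i) 0))).
rewrite !mevalM.
have /eqP -> : (point_form (q (w i))).@[q (w i) 0] == 0.
  by rewrite point_form_eq0 // submx_refl.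
by rewrite mulr0 => /eqP; rewrite mulf_eq0 (negPf MQ) orbF => /eqP.
Qed.
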